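(* Let $t_1,t_2,t_3$ be three distinct tangent lines to $\mathcal O$, and let $P=t_1\cap t_2$, $Q=t_2\cap t_3$, $R=t_1\cap t_3$ (so $\Delta=\{\alpha_P,\alpha_Q,\alpha_R\}$ is a triangle tangent to $\mathcal O$). Then $H=\langle\alpha_P,\alpha_Q,\alpha_R\rangle$ is isomorphic to $\mathrm{PSL}(2,p)$ if $p\equiv 1\pmod 4$, and to $\mathrm{PGL}(2,p)$ if $p\equiv 3\pmod 4$.
   Context: Throughout, $q=p^n$ with $p$ an odd prime and $n\ge 1$; $\pi=\mathrm{PG}(2,q)$ is the Desarguesian projective plane over $\mathbb F_q$ and $\mathcal O$ is a fixed non-degenerate conic of $\pi$. $G$ denotes the group of projectivities of $\pi$ preserving $\mathcal O$, identified with $\mathrm{PGL}(2,q)$. Every involution of $G$ is a perspectivity with a center (a point not on $\mathcal O$), and for every point $X\in\pi\setminus\mathcal O$ there is exactly one involution $\alpha_X\in G$ with center $X$. A line is tangent to $\mathcal O$ if it meets $\mathcal O$ in exactly one point. *)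

(* Defs.v *)
From HB Require Import structures.
From mathcomp Require Import all_boot all_order all_algebra all_fingroup all_solvable all_field.
Set Implicit Arguments. Unset Strict Implicit. Unset Printing Implicit Defensive.
Import GRing.Theory.

Local Open Scope ring_scope.

Section PG2.
Variable F : finFieldType.

(* Points of PG(2,F): nonzero row vectors of F^3 normalised so that their
   first nonzero coordinate equals 1 (one representative per 1-dim subspace). *)
Definition pnormal (u : 'rV[F]_3) : bool :=
  [exists i : 'I_3, (u 0 i == 1) && [forall j : 'I_3, (j < i)%N ==> (u 0 j == 0)]].

Definition point := {u : 'rV[F]_3 | pnormal u}.

Definition line_through (a b : point) : {set point} :=
  [set x : point | (val x <= val a + val b)%MS].

Definition is_line (L : {set point}) : bool :=
  [exists a : point, exists b : point, (a != b) && (L == line_through a b)].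

Definition conic (C : 'M[F]_3) : {set point} :=
  [set x : point | (val x *m C *m (val x)^T) 0 0 == 0].

(* Non-degenerate conic (q odd): symmetric matrix with nonzero determinant. *)
Definition nondeg_conic_mx (C : 'M[F]_3) : bool := (C^T == C) && (\det C != 0).

Definition induced_by (M : 'M[F]_3) (s : {perm point}) : bool :=
  (M \in unitmx) && [forall x : point, (val x *m M == val (s x))%MS].

Definition projectivity (s : {perm point}) : bool :=
  [exists M : 'M[F]_3, induced_by M s].

Definition conic_group (O : {set point}) : {set {perm point}} :=
  [set s : {perm point} | projectivity s && [forall x : point, (s x \in O) == (x \in O)]].

Definition perspectivity_center (s : {perm point}) (X : point) : bool :=
  [forall Y : point, (Y != X) ==> (s @: line_through X Y == line_through X Y)]
  && [exists L : {set point}, is_line L && [forall x in L, s x == x]].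

Definition involution (s : {perm point}) : bool := (s != 1%g) && (s ^+ 2 == 1)%g.

(* alpha_X : the (unique) involution of G with center X. *)
Definition alpha (O : {set point}) (X : point) : {perm point} :=
  odflt 1%g [pick s in conic_group O | involution s && perspectivity_center s X].

Definition tangent_line (O : {set point}) (t : {set point}) : bool :=
  is_line t && (#|t :&: O| == 1%N).

End PG2.

Definition SL2 (p : nat) : {set {'GL_2(p)}} :=
  [set g : {'GL_2(p)} | \det (GLval g) == 1].

Definition PSL2 (p : nat) := (SL2 p / 'Z(SL2 p))%g.
Definition PGL2 (p : nat) := ('GL_2(p) / 'Z('GL_2(p)))%g.

(* Main.v *)
Require Import Defs.
From HB Require Import structures.
From mathcomp Require Import all_boot all_order all_algebra all_fingroup all_solvable all_field.
From mathcomp Require Import ring zify.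

(** Vectors [v1], [v2], [v3] representing the three points of tangency can be
    rescaled so that their pairwise products under the bilinear form of the
    conic are all equal. Then P, Q, R are [v1 + v2 - v3], [v2 + v3 - v1], [v1
    + v3 - v2], and the involution with center P fixes [v1] and [v2] and maps
    [v3] to [2 (v1 + v2) - v3]. In the frame [v1, v3 - v1 - v2, v2] the conic
    is the Veronese conic, so that GL(2,p) acts on the plane by symmetric
    squares with the scalars as kernel, and the three involutions are the
    images of matrices of determinant -1 over F_p. The products of the first
    of these with the others are the transvections of parameter 2, whence the
    three matrices generate a group containing SL(2,p). Finally -1 is a square
    in F_p iff p = 1 mod 4: then the generators lie in SL(2,p) up to scalars,
    while otherwise every element of GL(2,p) lies in the generated group up to
    scalars. *)

Set Implicit Arguments. Unset Strict Implicit. Unset Printing Implicit Defensive.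
Import GRing.Theory.
Local Open Scope ring_scope.

(** * Points as normalised vectors, and the permutations induced by matrices *)

Section Points.
Variable F : finFieldType.
Implicit Types (u v w : 'rV[F]_3) (x y : point F) (M N : 'M[F]_3) (a b : F).

Lemma pnormal_neq0 u : pnormal u -> u != 0.
Proof.
case/existsP=> i /andP[/eqP ui _]; apply/eqP => u0.
by move: ui; rewrite u0 mxE => /eqP; rewrite eq_sym oner_eq0.
Qed.

Lemma val_point_neq0 x : val x != 0.
Proof. exact: pnormal_neq0 (valP x). Qed.

Lemma pnormal_scale u : u != 0 -> exists2 a : F, a != 0 & pnormal (a *: u).
Proof.
case/rV0Pn=> i0 ui0.
case: (@arg_minnP _ i0 [pred i | u 0 i != 0] (@nat_of_ord 3) ui0) => i ui min_i.
exists (u 0 i)^-1; first by rewrite invr_neq0.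
apply/existsP; exists i; rewrite mxE mulVf // eqxx /=.
apply/forallP => j; apply/implyP => lt_ji; rewrite mxE mulf_eq0.
apply/orP; right; apply: contraTT lt_ji => uj; rewrite -leqNgt.
exact: min_i.
Qed.

(** The leading entries 1 of two proportional normalised vectors sit at the same index, and
    comparing them there gives [a = 1]. *)
Lemma pnormal_inj u v a : pnormal u -> pnormal v -> u = a *: v -> u = v.
Proof.
move=> /existsP[i /andP[/eqP ui /forallP u_lt]] /existsP[j /andP[/eqP vj /forallP v_lt]] Duv.
suff a1 : a = 1 by rewrite Duv a1 scale1r.
have Du k : u 0 k = a * v 0 k by rewrite Duv mxE.
have a_neq0 : a != 0.
  by apply: contra_eq_neq (Du i) => ->; rewrite ui mul0r oner_eq0.
case: (ltngtP i j) => [lt_ij|lt_ji|/val_inj eq_ij].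
- have := Du i; have /implyP/(_ lt_ij)/eqP -> := v_lt i.
  by rewrite ui mulr0 => /eqP; rewrite oner_eq0.
- have := Du j; have /implyP/(_ lt_ji)/eqP -> := u_lt j.
  by rewrite vj mulr1 => a0; rewrite -a0 eqxx in a_neq0.
- by have := Du i; rewrite ui eq_ij vj mulr1.
Qed.

Lemma pnormal_delta : pnormal (delta_mx 0 0 : 'rV[F]_3).
Proof. by apply/existsP; exists 0; rewrite mxE !eqxx /=; apply/forallP => j. Qed.

(* Junk value: the zero vector is sent to the point (1 : 0 : 0). *)
Definition pt u : point F :=
  odflt (Sub _ pnormal_delta) [pick x : point F | (val x == u)%MS].

Lemma ptP u : u != 0 -> exists2 a : F, a != 0 & val (pt u) = a *: u.
Proof.
move=> u_neq0; rewrite /pt; case: pickP => [x /andP[/sub_rVP[a Dx] _]|noP] /=.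
  exists a => //; apply: contra_eq_neq Dx => ->.
  by rewrite scale0r val_point_neq0.
have [a a_neq0 nau] := pnormal_scale u_neq0.
have := noP (Sub _ nau); rewrite SubK => /negP[].
exact/eqmxP/eqmx_scale.
Qed.

Lemma pt_eqP u v : u != 0 -> v != 0 ->
  reflect (exists a, u = a *: v) (pt u == pt v).
Proof.
move=> u0 v0; apply: (iffP eqP) => [Euv | [d Duv]];
  have [a a0 Du] := ptP u0; have [b b0 Dv] := ptP v0.
  exists (a^-1 * b); move: (congr1 val Euv); rewrite Du Dv => /(congr1 (GRing.scale a^-1)).
  by rewrite !scalerA mulVf // scale1r.
apply: val_inj; apply: (@pnormal_inj _ _ (a * d * b^-1)); rewrite ?(valP (pt _)) //.
by rewrite Du Dv Duv !scalerA mulfVK.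
Qed.

Lemma val_ptK x : pt (val x) = x.
Proof.
have [a a0 Dx] := ptP (val_point_neq0 x).
by apply/val_inj/(pnormal_inj (valP (pt _)) (valP _) Dx).
Qed.

Lemma pt_scale a u : a != 0 -> pt (a *: u) = pt u.
Proof.
move=> a0; case: (eqVneq u 0) => [->|u0]; first by rewrite scaler0.
by apply/eqP/pt_eqP => //; [rewrite scaler_eq0 negb_or a0 | exists a].
Qed.

Lemma eqmx_pt u : u != 0 -> (val (pt u) :=: u)%MS.
Proof. by case/ptP=> a a0 ->; apply: eqmx_scale. Qed.

Lemma pt_in_line u x y : u != 0 ->
  (pt u \in line_through x y) = (u <= val x + val y)%MS.
Proof. by move=> u0; rewrite inE (eqmx_pt u0). Qed.

Lemma mulmx_unit_neq0 u M : M \in unitmx -> u != 0 -> u *m M != 0.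
Proof.
move=> uM; apply: contraNneq => uM0.
by rewrite -(mulmxK uM u) uM0 mul0mx.
Qed.

Definition pmap M x := pt (val x *m M).

Lemma pmap_pt M u : M \in unitmx -> u != 0 -> pmap M (pt u) = pt (u *m M).
Proof.
move=> uM u0; rewrite /pmap; have [a a0 ->] := ptP u0.
by rewrite -scalemxAl pt_scale.
Qed.

Lemma pmap_comp M N x : M \in unitmx -> N \in unitmx ->
  pmap N (pmap M x) = pmap (M *m N) x.
Proof.
move=> uM uN; rewrite {2}/pmap pmap_pt ?mulmx_unit_neq0 ?val_point_neq0 //.
by rewrite /pmap mulmxA.
Qed.

Lemma pmap1 x : pmap 1%:M x = x.
Proof. by rewrite /pmap mulmx1 val_ptK. Qed.

Lemma pmap_inj M : M \in unitmx -> injective (pmap M).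
Proof.
move=> uM; apply: (can_inj (g := pmap (invmx M))) => x.
by rewrite pmap_comp ?unitmx_inv // mulmxV // pmap1.
Qed.

(* Junk value: a singular matrix induces the identity. *)
Definition pperm M : {perm point F} :=
  if insub M is Some M' then perm (pmap_inj (valP (M' : {M | M \in unitmx})))
  else 1%g.

Lemma ppermE M x : M \in unitmx -> pperm M x = pmap M x.
Proof. by move=> uM; rewrite /pperm (insubT (fun M => M \in unitmx) uM) permE. Qed.

Lemma pperm_pt M u : M \in unitmx -> u != 0 -> pperm M (pt u) = pt (u *m M).
Proof. by move=> uM u0; rewrite ppermE // pmap_pt. Qed.

Lemma ppermM M N : M \in unitmx -> N \in unitmx ->
  pperm (M *m N) = (pperm M * pperm N)%g.
Proof.
move=> uM uN; apply/permP => x.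
by rewrite permM !ppermE ?unitmx_mul ?uM // pmap_comp.
Qed.

Lemma pperm1 : pperm 1%:M = 1%g.
Proof. by apply/permP => x; rewrite ppermE ?unitmx1 // pmap1 perm1. Qed.

Lemma ppermZ a M : M \in unitmx -> a != 0 -> pperm (a *: M) = pperm M.
Proof.
move=> uM a0; have uaM : a *: M \in unitmx by rewrite unitmxZ ?unitfE.
by apply/permP => x; rewrite !ppermE // /pmap -scalemxAr pt_scale.
Qed.

Lemma induced_by_pperm M : M \in unitmx -> induced_by M (pperm M).
Proof.
move=> uM; rewrite /induced_by uM; apply/forallP => x; apply/eqmxP/eqmx_sym.
by rewrite ppermE //; apply/eqmx_pt/mulmx_unit_neq0/val_point_neq0.
Qed.

(** Reduces the projectivities of the conic group to permutations [pperm M], so that they can be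
    handled by matrix computations. *)
Lemma induced_byE M s : induced_by M s -> s = pperm M.
Proof.
case/andP=> uM /forallP Ms; apply/permP => x; rewrite ppermE // /pmap.
have /andP[/sub_rVP[a Da] _] := Ms x.
have a0 : a != 0.
  apply: contra_eq_neq Da => ->; rewrite scale0r.
  by rewrite mulmx_unit_neq0 ?val_point_neq0.
by rewrite Da pt_scale // val_ptK.
Qed.

End Points.

(** * Row vectors and matrices given by explicit entries *)

Section Rows.
Variable R : comNzRingType.

Definition row3 (a b c : R) : 'rV[R]_3 := \row_j [:: a; b; c]`_j.

Definition rows3 (v1 v2 v3 : 'rV[R]_3) : 'M[R]_3 :=
  \matrix_(i < 3) [:: v1; v2; v3]`_i.

Lemma row3P (u : 'rV[R]_3) : exists a b c, u = row3 a b c.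
Proof.
exists (u 0 0), (u 0 1), (u 0 (lift 0 1)); apply/rowP => j; rewrite mxE.
by case: j => [[|[|[|]]]] //= ?; congr (u _ _); apply/val_inj.
Qed.

Lemma mul_row3_rows3 a b c v1 v2 v3 :
  row3 a b c *m rows3 v1 v2 v3 = a *: v1 + b *: v2 + c *: v3.
Proof.
by rewrite mulmx_sum_row !big_ord_recl big_ord0 !mxE !rowK /= addr0 addrA.
Qed.

End Rows.

(** * The bilinear form of the conic *)

Section Form.
Variables (F : finFieldType) (C : 'M[F]_3).
Implicit Types (u v w : 'rV[F]_3) (x y : point F).

Definition bform u w : F := (u *m C *m w^T) 0 0.

Lemma bformDl u v w : bform (u + v) w = bform u w + bform v w.
Proof. by rewrite /bform !mulmxDl mxE. Qed.

Lemma bformDr u v w : bform u (v + w) = bform u v + bform u w.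
Proof. by rewrite /bform linearD mulmxDr mxE. Qed.

Lemma bformZl a u w : bform (a *: u) w = a * bform u w.
Proof. by rewrite /bform -!scalemxAl mxE. Qed.

Lemma bformZr a u w : bform u (a *: w) = a * bform u w.
Proof. by rewrite /bform linearZ /= -!scalemxAr mxE. Qed.

Definition bformE := (bformDl, bformDr, bformZl, bformZr).

Lemma bformC u w : C^T = C -> bform u w = bform w u.
Proof.
move=> symC; rewrite /bform; transitivity ((u *m C *m w^T)^T 0 0); first by rewrite [RHS]mxE.
by rewrite !trmx_mul trmxK symC mulmxA.
Qed.

Lemma in_conic x : (x \in conic C) = (bform (val x) (val x) == 0).
Proof. by rewrite inE. Qed.

Lemma pt_in_conic u : u != 0 -> (pt u \in conic C) = (bform u u == 0).
Proof.
move=> u0; rewrite in_conic; have [a a0 ->] := ptP u0.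
by rewrite !bformE !mulf_eq0 (negbTE a0).
Qed.

End Form.

Lemma pt_in_lineP (F : finFieldType) (u v w : 'rV[F]_3) : u != 0 -> v != 0 -> w != 0 ->
  reflect (exists a b, w = a *: u + b *: v) (pt w \in line_through (pt u) (pt v)).
Proof.
move=> u0 v0 w0; rewrite pt_in_line // (adds_eqmx (eqmx_pt u0) (eqmx_pt v0)).
apply: (iffP sub_addsmxP) => [[[x y] /= ->] | [a [b ->]]].
  by exists (x 0 0), (y 0 0); rewrite -!mul_scalar_mx -!mx11_scalar.
by exists (a%:M, b%:M); rewrite /= !mul_scalar_mx.
Qed.

(** * Three conic points with equal pairwise products *)

Section Triangle.
Variables (F : finFieldType) (C : 'M[F]_3) (v1 v2 v3 : 'rV[F]_3) (c : F).
Hypotheses (two_neq0 : 2%:R != 0 :> F) (symC : C^T = C) (c_neq0 : c != 0).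
Hypotheses (g11 : bform C v1 v1 = 0) (g22 : bform C v2 v2 = 0) (g33 : bform C v3 v3 = 0).
Hypotheses (g12 : bform C v1 v2 = c) (g13 : bform C v1 v3 = c) (g23 : bform C v2 v3 = c).

Definition comb3 (y1 y2 y3 : F) := y1 *: v1 + y2 *: v2 + y3 *: v3.

Lemma bform_comb3 x1 x2 x3 y1 y2 y3 :
  bform C (comb3 x1 x2 x3) (comb3 y1 y2 y3) =
    c * (x1 * y2 + x1 * y3 + x2 * y1 + x2 * y3 + x3 * y1 + x3 * y2).
Proof.
rewrite /comb3 !bformE (bformC v2 v1) // (bformC v3 v1) // (bformC v3 v2) //.
by rewrite g11 g22 g33 g12 g13 g23; ring.
Qed.

Lemma comb3D x1 x2 x3 y1 y2 y3 :
  comb3 x1 x2 x3 + comb3 y1 y2 y3 = comb3 (x1 + y1) (x2 + y2) (x3 + y3).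
Proof. by rewrite /comb3 !scalerDl [LHS]addrACA; congr (_ + _); rewrite addrACA. Qed.

Lemma comb3Z a x1 x2 x3 : a *: comb3 x1 x2 x3 = comb3 (a * x1) (a * x2) (a * x3).
Proof. by rewrite /comb3 !scalerDr !scalerA. Qed.

(** The Gram matrix of [v1], [v2], [v3] is [c] times the matrix with 0 on the diagonal and 1
    elsewhere. Pairing with (-1, 1, 1) and its permutations isolates one coordinate, multiplied by
    [2 c], which is nonzero. *)
Lemma comb3_inj x1 x2 x3 y1 y2 y3 :
  comb3 x1 x2 x3 = comb3 y1 y2 y3 -> [/\ x1 = y1, x2 = y2 & x3 = y3].
Proof.
move=> Exy.
have Eb z1 z2 z3 : c * ((y1 - x1) * (z2 + z3) + (y2 - x2) * (z1 + z3) + (y3 - x3) * (z1 + z2)) = 0.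
  transitivity (bform C (comb3 y1 y2 y3) (comb3 z1 z2 z3) -
    bform C (comb3 x1 x2 x3) (comb3 z1 z2 z3)); last by rewrite Exy subrr.
  by rewrite !bform_comb3; ring.
have E0 a : c * (2%:R * a) = 0 -> a = 0.
  by move/eqP; rewrite !mulf_eq0 (negbTE c_neq0) (negbTE two_neq0) => /eqP.
split; apply/esym/eqP; rewrite -subr_eq0; apply/eqP; apply: E0.
- by rewrite -(Eb (-1) 1 1); ring.
- by rewrite -(Eb 1 (-1) 1); ring.
- by rewrite -(Eb 1 1 (-1)); ring.
Qed.

Lemma comb3_eq0 x1 x2 x3 :
  (comb3 x1 x2 x3 == 0) = [&& x1 == 0, x2 == 0 & x3 == 0].
Proof.
have E0 : comb3 0 0 0 = 0 by rewrite /comb3 !scale0r !addr0.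
apply/eqP/and3P => [|[/eqP-> /eqP-> /eqP-> //]].
by rewrite -[RHS]E0 => /comb3_inj[-> -> ->].
Qed.

(* In these coordinates the conic is [x * z = y ^+ 2], parametrised by
   (s ^+ 2, s * t, t ^+ 2), and [v1], [v2], [v3] are the points
   (s : t) = (1 : 0), (0 : 1), (1 : 1). *)
Definition frame := rows3 v1 (v3 - v1 - v2) v2.

Lemma mul_row3_frame x y z : row3 x y z *m frame = comb3 (x - y) (z - y) y.
Proof.
rewrite mul_row3_rows3 /comb3 !scalerBr !scalerBl.
by rewrite !addrA [LHS](AC (5) (1*3*5*4*2))%AC.
Qed.

Lemma frame_unit : frame \in unitmx.
Proof.
rewrite -row_free_unit; apply: inj_row_free => u.
have [x [y [z ->]]] := row3P u; rewrite mul_row3_frame => /eqP.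
rewrite comb3_eq0 => /and3P[xy zy /eqP y0]; move: xy zy; rewrite y0 !subr0.
by move=> /eqP-> /eqP->; apply/rowP => -[[|[|[|]]]] //= ?; rewrite !mxE.
Qed.

Lemma comb3P u : exists y1 y2 y3, u = comb3 y1 y2 y3.
Proof.
have [x [y [z Du]]] := row3P (u *m invmx frame).
exists (x - y), (z - y), y.
by rewrite -mul_row3_frame -Du mulmxKV ?frame_unit.
Qed.

Lemma comb3_100 : v1 = comb3 1 0 0.
Proof. by rewrite /comb3 !scale0r scale1r !addr0. Qed.

Lemma comb3_010 : v2 = comb3 0 1 0.
Proof. by rewrite /comb3 !scale0r scale1r addr0 add0r. Qed.

Lemma comb3_001 : v3 = comb3 0 0 1.
Proof. by rewrite /comb3 !scale0r scale1r !add0r. Qed.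

(** This vector is orthogonal to [v1] and [v2], so it represents the intersection of the tangents
    there; permuting the three vectors gives the other vertices of the triangle. *)
Definition vertex := comb3 1 1 (-1).

Lemma vertex_neq0 : vertex != 0.
Proof. by rewrite comb3_eq0 oner_eq0. Qed.

Lemma pole_vertex u : u != 0 -> bform C v1 u = 0 -> bform C v2 u = 0 ->
  pt u = pt vertex.
Proof.
have [y1 [y2 [y3 ->]]] := comb3P u.
rewrite {1}comb3_100 {1}comb3_010 !bform_comb3 => u0.
have E0 a b : c * a = 0 -> a = b -> b = 0.
  by move/eqP; rewrite mulf_eq0 (negbTE c_neq0) => /eqP -> ->.
move=> /(E0 _ (y2 + y3)) e1 /(E0 _ (y1 + y3)) e2.
have {}e1 : y2 = - y3 by apply/eqP; rewrite -addr_eq0 e1 //; ring.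
have {}e2 : y1 = - y3 by apply/eqP; rewrite -addr_eq0 e2 //; ring.
apply/eqP/pt_eqP; rewrite ?vertex_neq0 //; exists (- y3).
by rewrite /vertex comb3Z e1 e2 mulr1 mulrN1 opprK.
Qed.

(** * The involution centered at a vertex: existence and uniqueness *)

Section Reflection.
Variable M : 'M[F]_3.
Hypotheses (Mv1 : v1 *m M = v1) (Mv2 : v2 *m M = v2).
Hypothesis (Mv3 : v3 *m M = 2%:R *: (v1 + v2) - v3).

(** With [w = vertex], b(w,w) = -2c and b(v3,w) = 2c, so [M] is the orthogonal reflection sending u
    to u - 2 b(u,w) / b(w,w) w. *)
Lemma comb3_refl y1 y2 y3 :
  comb3 y1 y2 y3 *m M = comb3 (y1 + 2%:R * y3) (y2 + 2%:R * y3) (- y3).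
Proof.
rewrite {1}/comb3 !mulmxDl -!scalemxAl Mv1 Mv2 Mv3.
rewrite comb3_100 comb3_010 comb3_001 -scaleN1r !(comb3Z, comb3D).
by congr comb3; ring.
Qed.

Lemma refl_invol : M *m M = 1%:M.
Proof.
apply/row_matrixP => i; rewrite !rowE mulmx1 mulmxA.
have [y1 [y2 [y3 ->]]] := comb3P (delta_mx 0 i).
by rewrite !comb3_refl; congr comb3; ring.
Qed.

Lemma refl_unit : M \in unitmx.
Proof. by case/mulmx1_unit: refl_invol. Qed.

(** This is why every line through the center is preserved. *)
Lemma refl_vertexE u : exists a, u *m M = a *: vertex + u.
Proof.
have [y1 [y2 [y3 ->]]] := comb3P u; exists (2%:R * y3).
by rewrite comb3_refl comb3Z comb3D; congr comb3; ring.
Qed.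

Lemma refl_conic_group : pperm M \in conic_group (conic C).
Proof.
rewrite inE; apply/andP; split.
  by apply/existsP; exists M; apply/induced_by_pperm/refl_unit.
apply/forallP => x; rewrite -(val_ptK x) pperm_pt ?refl_unit ?val_point_neq0 //.
rewrite !pt_in_conic ?mulmx_unit_neq0 ?refl_unit ?val_point_neq0 //.
have [y1 [y2 [y3 ->]]] := comb3P (val x).
by rewrite comb3_refl !bform_comb3; apply/eqP; congr (_ * _ == 0); ring.
Qed.

Lemma refl_involution : involution (pperm M).
Proof.
rewrite /involution expgS expg1 -ppermM ?refl_unit // refl_invol pperm1 eqxx andbT.
apply/eqP => M1.
have v3_neq0 : v3 != 0 by rewrite comb3_001 comb3_eq0 oner_eq0 !andbF.
have /eqP/(pt_eqP (mulmx_unit_neq0 refl_unit v3_neq0) v3_neq0)[a] :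
  pt (v3 *m M) = pt v3 by rewrite -pperm_pt ?refl_unit // M1 perm1.
rewrite comb3_001 comb3_refl comb3Z => /comb3_inj[/eqP + _ _].
by rewrite mulr0 mulr1 add0r (negbTE two_neq0).
Qed.

Lemma refl_center : perspectivity_center (pperm M) (pt vertex).
Proof.
apply/andP; split.
  apply/forallP => Y; apply/implyP => _.
  rewrite eqEcard card_imset ?leqnn ?andbT; last exact: perm_inj.
  apply/subsetP => _ /imsetP[x xL ->]; move: xL.
  rewrite -(val_ptK Y) -(val_ptK x).
  set y := val Y; set u := val x.
  have [u0 y0] : u != 0 /\ y != 0 by rewrite !val_point_neq0.
  case/(pt_in_lineP vertex_neq0 y0 u0) => a [b Du].
  rewrite pperm_pt ?refl_unit //; have [d Dd] := refl_vertexE u.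
  apply/pt_in_lineP; rewrite ?vertex_neq0 ?mulmx_unit_neq0 ?refl_unit //.
  by exists (d + a), b; rewrite Dd {1}Du addrA scalerDl.
have v1_neq0 : v1 != 0 by rewrite comb3_100 comb3_eq0 oner_eq0.
have v2_neq0 : v2 != 0 by rewrite comb3_010 comb3_eq0 oner_eq0 andbF.
(* The axis is the polar of the center, the line joining the two points of tangency. *)
apply/existsP; exists (line_through (pt v1) (pt v2)); apply/andP; split.
  apply/existsP; exists (pt v1); apply/existsP; exists (pt v2); rewrite eqxx andbT.
  apply/negP => /(pt_eqP v1_neq0 v2_neq0)[a].
  rewrite {1}comb3_100 comb3_010 comb3Z => /comb3_inj[/eqP].
  by rewrite mulr0 oner_eq0.
apply/forallP => x; apply/implyP; rewrite -(val_ptK x).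
case/(pt_in_lineP v1_neq0 v2_neq0 (val_point_neq0 x)) => a [b Dx].
rewrite pperm_pt ?refl_unit ?val_point_neq0 //.
by rewrite Dx mulmxDl -!scalemxAl Mv1 Mv2.
Qed.

(* The tangents [v1], [v2] through the center are preserved, so these points are
   fixed; on [v3] the equation of the conic only leaves the identity and
   the reflection. *)
Lemma refl_unique s : s \in conic_group (conic C) -> involution s ->
  perspectivity_center s (pt vertex) -> s = pperm M.
Proof.
rewrite inE => /andP[/existsP[N /[dup] /andP[uN _] /induced_byE ->]] /forallP sO.
case/andP=> s_neq1 _ /andP[/forallP sC _].
have line u : u != 0 -> pt u != pt vertex ->
    (exists a b, u *m N = a *: vertex + b *: u) /\
    (exists a b, vertex *m N = a *: vertex + b *: u).
  move=> u0 uP; have /implyP/(_ uP)/eqP sL := sC (pt u).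
  have inL w : w != 0 -> (exists a b, w = a *: vertex + b *: u) ->
      exists a b, w *m N = a *: vertex + b *: u.
    move=> w0 /(pt_in_lineP vertex_neq0 u0 w0) /(imset_f (pperm N)).
    rewrite sL pperm_pt // => /pt_in_lineP; apply; rewrite ?vertex_neq0 //.
    exact: mulmx_unit_neq0.
  split; apply: inL; rewrite ?vertex_neq0 //.
    by exists 0, 1; rewrite scale0r scale1r add0r.
  by exists 1, 0; rewrite scale0r scale1r addr0.
have iso u : u != 0 -> bform C u u = 0 -> bform C (u *m N) (u *m N) = 0.
  move=> u0 uO; apply/eqP; rewrite -pt_in_conic ?mulmx_unit_neq0 //.
  by rewrite -pperm_pt // (eqP (sO _)) pt_in_conic // uO.
have v1_neq0 : comb3 1 0 0 != 0 by rewrite comb3_eq0 oner_eq0.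
have v2_neq0 : comb3 0 1 0 != 0 by rewrite comb3_eq0 oner_eq0 andbF.
have v3_neq0 : comb3 0 0 1 != 0 by rewrite comb3_eq0 oner_eq0 !andbF.
have notP y1 y2 y3 : comb3 y1 y2 y3 != 0 -> (y1 == 0) || (y2 == 0) ->
    pt (comb3 y1 y2 y3) != pt vertex.
  move=> y0 z0; apply/negP => /(pt_eqP y0 vertex_neq0)[a].
  rewrite /vertex comb3Z => /comb3_inj[y1a y2a y3a]; move: y0 z0.
  by rewrite comb3_eq0 y1a y2a y3a !mulf_eq0 oppr_eq0 oner_eq0 !orbF; case: eqP.
have := line _ v1_neq0; case; first by rewrite notP // eqxx ?orbT.
rewrite /vertex => -[a1 [l1 E1]] [m [m1 EP]].
have := line _ v2_neq0; case; first by rewrite notP // eqxx ?orbT.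
rewrite /vertex => -[a2 [l2 E2]] [m' [m2 EP']].
have := line _ v3_neq0; case; first by rewrite notP // eqxx ?orbT.
rewrite /vertex => -[a3 [l3 E3]] _.
have I1 := iso _ v1_neq0; have I2 := iso _ v2_neq0; have I3 := iso _ v3_neq0.
rewrite E1 !(comb3Z, comb3D) !bform_comb3 in I1.
rewrite E2 !(comb3Z, comb3D) !bform_comb3 in I2.
rewrite E3 !(comb3Z, comb3D) !bform_comb3 in I3.
(* The premise of each fact, that the basis vector is isotropic, has become a polynomial
   identity. *)
have {}I1 := I1 ltac:(ring); have {}I2 := I2 ltac:(ring); have {}I3 := I3 ltac:(ring).
have c2_neq0 : c * 2%:R != 0 by rewrite mulf_neq0.
have sq0 a : c * 2%:R * (- a ^+ 2) = 0 -> a = 0.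
  by move/eqP; rewrite mulf_eq0 (negbTE c2_neq0) oppr_eq0 expf_eq0 => /eqP.
have {I1} a10 : a1 = 0 by apply: sq0; rewrite -I1; ring.
have {I2} a20 : a2 = 0 by apply: sq0; rewrite -I2; ring.
have {I3} : c * 2%:R * (a3 * (2%:R * l3 - a3)) = 0 by rewrite -I3; ring.
move/eqP; rewrite mulf_eq0 (negbTE c2_neq0) mulf_eq0 subr_eq0 /= => Da3.
(* The image of the center lies on the lines joining the center to [v1] and to [v2], hence is the
   center. *)
have m1_0 : m1 = 0.
  move: EP; rewrite EP' !(comb3Z, comb3D) => /comb3_inj[+ _].
  rewrite !mulr1 !mulr0 !addr0 => -> /eqP; rewrite !mulrN1 eqr_opp => /eqP Dm.
  by apply: (addrI m); rewrite -[in RHS]Dm addr0.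
have DN y1 y2 y3 : comb3 y1 y2 y3 *m N =
    comb3 (y1 * l1 + y3 * a3) (y2 * l2 + y3 * a3) (y3 * (l3 - a3)).
  transitivity (y1 *: (comb3 1 0 0 *m N) + y2 *: (comb3 0 1 0 *m N) + y3 *: (comb3 0 0 1 *m N)).
    rewrite !scalemxAl -!mulmxDl; congr (_ *m N).
    by rewrite !(comb3Z, comb3D); congr comb3; ring.
  rewrite E1 E2 E3 a10 a20 !(comb3Z, comb3D); congr comb3; ring.
(* As [vertex] is an eigenvector for [m], comparing coordinates gives l1 = l2 = l3 = m + a3. *)
move: EP; rewrite m1_0 DN !(comb3Z, comb3D) => /comb3_inj[el1 el2 el3].
have {}el1 : l1 = m + a3.
  by apply/eqP; rewrite -subr_eq; apply/eqP; rewrite -[l1]mul1r -mulN1r el1; ring.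
have {}el2 : l2 = m + a3.
  by apply/eqP; rewrite -subr_eq; apply/eqP; rewrite -[l2]mul1r -mulN1r el2; ring.
have {}el3 : l3 = m + a3.
  apply/eqP; rewrite -subr_eq; apply/eqP/oppr_inj.
  by rewrite -[LHS]mulN1r el3; ring.
set l := m + a3 in el1 el2 el3; move: DN; rewrite el1 el2 el3 => DN.
have l_neq0 : l != 0.
  apply: contra_neq (mulmx_unit_neq0 uN v1_neq0) => l0.
  by rewrite DN l0; apply/eqP; rewrite comb3_eq0 !mulr0 !mul0r addr0 eqxx.
have mxext (N' : 'M[F]_3) :
    (forall y1 y2 y3, comb3 y1 y2 y3 *m N = comb3 y1 y2 y3 *m N') -> N = N'.
  move=> eqN; apply/row_matrixP => i; rewrite !rowE.
  by have [y1 [y2 [y3 ->]]] := comb3P (delta_mx 0 i).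
(* If a3 = 0 then [N] is scalar and induces the identity, which is excluded; if a3 = 2 l then [N] is
   [l] times the reflection. *)
case/orP: Da3 => [/eqP a30 | /eqP a3l].
  have NE : N = l *: 1%:M.
    apply: mxext => y1 y2 y3; rewrite DN a30 -scalemxAr mulmx1 comb3Z.
    by congr comb3; ring.
  by move: s_neq1; rewrite NE ppermZ ?unitmx1 // pperm1 eqxx.
have -> : N = l *: M; last by rewrite ppermZ ?refl_unit.
apply: mxext => y1 y2 y3; rewrite DN -a3l el3 -scalemxAr comb3_refl comb3Z.
by congr comb3; ring.
Qed.

(** Uniqueness identifies whatever [pick] returns, and existence rules out the default value 1. *)
Lemma alpha_refl : alpha (conic C) (pt vertex) = pperm M.
Proof.
rewrite /alpha; case: pickP => [s /and3P[sG si sc] | /(_ (pperm M))] /=.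
  exact: refl_unique.
by rewrite refl_conic_group refl_involution refl_center.
Qed.

End Reflection.
End Triangle.

(** * Tangent lines as polars, and the normalisation of the points of tangency *)

Section Tangents.
Variables (F : finFieldType) (C : 'M[F]_3).
Hypotheses (two_neq0 : 2%:R != 0 :> F) (nondegC : nondeg_conic_mx C).
Implicit Types (x y T P : point F) (t : {set point F}).

Let symC : C^T = C. Proof. by case/andP: nondegC => /eqP. Qed.

Let unitC : C \in unitmx.
Proof. by case/andP: nondegC => _; rewrite unitmxE unitfE. Qed.

Definition polar T : {set point F} := [set x | bform C (val T) (val x) == 0].

Lemma in_polar T x : (x \in polar T) = (val x <= kermx (C *m (val T)^T))%MS.
Proof.
rewrite inE bformC //; rewrite /bform -mulmxA; apply/eqP/sub_kermxP => b0.
  by rewrite [LHS]mx11_scalar b0; apply: raddf0.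
by rewrite b0 mxE.
Qed.

Lemma rank_polar T : \rank (kermx (C *m (val T)^T)) = 2%N.
Proof.
rewrite mxrank_ker -mxrank_tr trmx_mul trmxK symC rank_rV.
by rewrite mulmx_unit_neq0 ?val_point_neq0.
Qed.

Lemma rank_line x y : x != y -> (1 < \rank (val x + val y)%MS)%N.
Proof.
move=> neq_xy.
suff: (\rank (val x) < \rank (val x + val y)%MS)%N by rewrite {1}rank_rV val_point_neq0.
apply: rank_ltmx; rewrite ltmxE addsmxSl /=; apply: contra neq_xy => le_yx.
have /sub_rVP[a Da] : (val y <= val x)%MS by apply: submx_trans le_yx; apply: addsmxSr.
by rewrite eq_sym; apply/eqP/val_inj/(pnormal_inj (valP _) (valP _) Da).
Qed.

(* If [x] on a line through the conic point [T] is not orthogonal to [T], then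
   the line carries the second conic point [x - (b(x,x) / 2 b(T,x)) T]. *)
Lemma tangent_polar t : tangent_line (conic C) t ->
  exists2 T, t :&: conic C = [set T] & t = polar T.
Proof.
case/andP=> /existsP[a /existsP[b /andP[neq_ab /eqP Dt]]] /cards1P[T DT].
exists T => //.
have /setIP[Tt TO] : T \in t :&: conic C by rewrite DT set11.
have sub_tT : {subset t <= polar T}.
  move=> x xt; rewrite inE; apply/negPn/negP => nTx.
  set b0 := bform C _ _ in nTx.
  have TO0 : bform C (val T) (val T) = 0 by apply/eqP; rewrite -in_conic.
  pose u := val x + (- (bform C (val x) (val x) / (2%:R * b0))) *: val T.
  have Tu : bform C (val T) u = b0 by rewrite /u !bformE TO0 mulr0 addr0.
  have u0 : u != 0.
    by apply: contraNneq nTx => u0; rewrite -Tu u0 /bform trmx0 mulmx0 mxE.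
  have uO : bform C u u = 0.
    rewrite {1}/u bformDl bformZl Tu /u !bformE (bformC (val x) (val T)) // -/b0.
    by field; rewrite nTx two_neq0.
  have : pt u \in t :&: conic C.
    rewrite inE pt_in_conic // uO eqxx andbT Dt pt_in_line //.
    rewrite addmx_sub // ?scalemx_sub //.
      by move: xt; rewrite Dt inE.
    by move: Tt; rewrite Dt inE.
  (* Now [u] is a multiple of the isotropic vector of [T], contradicting that its product with [T]
     is [b0]. *)
  rewrite DT inE -[X in _ == X]val_ptK => /(pt_eqP u0 (val_point_neq0 T))[k Du].
  by move: nTx; rewrite -Tu Du bformZr TO0 mulr0 eqxx.
have le_tT : (val a + val b <= kermx (C *m (val T)^T))%MS.
  by rewrite addsmx_sub -!in_polar !sub_tT // Dt inE ?addsmxSl ?addsmxSr.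
apply/setP => x; apply/idP/idP => [/sub_tT //|].
rewrite in_polar Dt inE => /submx_trans; apply.
(* A line has rank at least 2 and the polar rank 2, so the inclusion is an equality. *)
rewrite -(mxrank_leqif_sup le_tT) eqn_leq mxrankS //=.
by rewrite rank_polar rank_line.
Qed.

(** If the product vanished, [T2] would be a conic point on the tangent at [T1], hence equal to
    [T1], and the tangents would coincide. *)
Lemma tangent_points_nonorthogonal t1 t2 T1 T2 :
  t1 :&: conic C = [set T1] -> t1 = polar T1 ->
  t2 :&: conic C = [set T2] -> t2 = polar T2 ->
  t1 != t2 -> bform C (val T1) (val T2) != 0.
Proof.
move=> DT1 Dt1 DT2 Dt2; apply: contraNneq => T12.
suff DT : T2 = T1 by rewrite Dt1 Dt2 DT.
have /setIP[_ T2O] : T2 \in t2 :&: conic C by rewrite DT2 set11.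
apply/set1P; rewrite -DT1 inE T2O andbT Dt1 inE; exact/eqP.
Qed.

Lemma tangent_triangle t1 t2 t3 P Q R :
  tangent_line (conic C) t1 -> tangent_line (conic C) t2 ->
  tangent_line (conic C) t3 ->
  t1 != t2 -> t2 != t3 -> t1 != t3 ->
  t1 :&: t2 = [set P] -> t2 :&: t3 = [set Q] -> t1 :&: t3 = [set R] ->
  exists v1 v2 v3 c, c != 0 /\
   [/\ bform C v1 v1 = 0, bform C v2 v2 = 0 & bform C v3 v3 = 0] /\
   [/\ bform C v1 v2 = c, bform C v1 v3 = c & bform C v2 v3 = c] /\
   [/\ P = pt (vertex v1 v2 v3), Q = pt (vertex v2 v3 v1) & R = pt (vertex v1 v3 v2)].
Proof.
move=> /tangent_polar[T1 O1 D1] /tangent_polar[T2 O2 D2] /tangent_polar[T3 O3 D3].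
move=> n12 n23 n13 DP DQ DR.
have b12 := tangent_points_nonorthogonal O1 D1 O2 D2 n12.
have b23 := tangent_points_nonorthogonal O2 D2 O3 D3 n23.
have b13 := tangent_points_nonorthogonal O1 D1 O3 D3 n13.
have iso t T : t :&: conic C = [set T] -> bform C (val T) (val T) = 0.
  move=> DT; have /setIP[_ TO] : T \in t :&: conic C by rewrite DT set11.
  by apply/eqP; rewrite -in_conic.
have {O1} O1 := iso _ _ O1; have {O2} O2 := iso _ _ O2; have {O3} O3 := iso _ _ O3.
set c12 := bform C _ _ in b12; set c13 := bform C _ _ in b13; set c23 := bform C _ _ in b23.
(* Each vector is scaled by the product of the other two, which makes every pairwise product equal
   to c12 c13 c23. *)
pose v1 := c23 *: val T1; pose v2 := c13 *: val T2; pose v3 := c12 *: val T3.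
pose c := c12 * c13 * c23.
have c0 : c != 0 by rewrite !mulf_neq0.
have [g11 g22 g33] : [/\ bform C v1 v1 = 0, bform C v2 v2 = 0 & bform C v3 v3 = 0].
  by rewrite !bformE O1 O2 O3 !mulr0.
have [g12 g13 g23] : [/\ bform C v1 v2 = c, bform C v1 v3 = c & bform C v2 v3 = c].
  by rewrite !bformE -/c12 -/c13 -/c23 /c; split; ring.
have polarE T x a : x \in polar T -> bform C (a *: val T) (val x) = 0.
  by rewrite inE bformZl => /eqP ->; rewrite mulr0.
have /setIP[P1 P2] : P \in t1 :&: t2 by rewrite DP set11.
have /setIP[Q2 Q3] : Q \in t2 :&: t3 by rewrite DQ set11.
have /setIP[R1 R3] : R \in t1 :&: t3 by rewrite DR set11.
have g21 : bform C v2 v1 = c by rewrite bformC.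
have g31 : bform C v3 v1 = c by rewrite bformC.
have g32 : bform C v3 v2 = c by rewrite bformC.
rewrite D1 in P1 R1; rewrite D2 in P2 Q2; rewrite D3 in Q3 R3.
exists v1, v2, v3, c; split=> //; split=> //; split=> //.
(* Each vertex lies on two tangents, so it is orthogonal to two of the vectors and [pole_vertex]
   applies to them in the matching order. *)
split; rewrite -[LHS]val_ptK;
  apply: (pole_vertex two_neq0 symC c0) => //; by [apply: val_point_neq0 | apply: polarE].
Qed.

End Tangents.

(** * Matrices of size 2 and their symmetric squares *)

Section Matrix2.
Variable R : comNzRingType.
Implicit Types (a b c d : R) (g h : 'M[R]_2).

Definition mx22 a b c d : 'M[R]_2 :=
  \matrix_(i < 2, j < 2) (nth [::] [:: [:: a; b]; [:: c; d]] i)`_j.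

Lemma mx22P g : exists a b c d, g = mx22 a b c d.
Proof.
exists (g 0 0), (g 0 1), (g 1 0), (g 1 1); apply/matrixP => i j; rewrite mxE.
by case: i j => [[|[|]]] //= ? [[|[|]]] //= ?; congr (g _ _); apply: val_inj.
Qed.

Lemma mx22_inj a b c d a' b' c' d' : mx22 a b c d = mx22 a' b' c' d' ->
  [/\ a = a', b = b', c = c' & d = d'].
Proof.
move/matrixP => E; have := (E 0 0, E 0 1, E 1 0, E 1 1).
by rewrite !mxE /= => -[[[]]].
Qed.

Lemma mul_mx22 a b c d a' b' c' d' : mx22 a b c d *m mx22 a' b' c' d' =
  mx22 (a * a' + b * c') (a * b' + b * d') (c * a' + d * c') (c * b' + d * d').
Proof.
apply/matrixP => i j; rewrite !mxE !big_ord_recl big_ord0 !mxE /= addr0.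
by case: i j => [[|[|]]] //= ? [[|[|]]].
Qed.

Lemma scalar_mx22 a : a%:M = mx22 a 0 0 a.
Proof.
by apply/matrixP => i j; rewrite !mxE; case: i j => [[|[|]]] //= ? [[|[|]]].
Qed.

Lemma det_mx22 a b c d : \det (mx22 a b c d) = a * d - b * c.
Proof.
rewrite (expand_det_row _ 0) !big_ord_recl big_ord0 /cofactor !det_mx11 !mxE /=.
by rewrite !addn0 expr0 expr1 mul1r mulN1r mulrN addr0.
Qed.

(** The matrix by which [g] acts on the Veronese conic: it sends (s^2, s t, t^2) to the same
    expression in the entries of the row (s, t) g. *)
Definition sym2 g : 'M[R]_3 :=
  let: (a, b, c, d) := (g 0 0, g 0 1, g 1 0, g 1 1) in
  rows3 (row3 (a ^+ 2) (a * b) (b ^+ 2))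
        (row3 (2%:R * a * c) (a * d + b * c) (2%:R * b * d))
        (row3 (c ^+ 2) (c * d) (d ^+ 2)).

Lemma row3D a b c a' b' c' : row3 a b c + row3 a' b' c' = row3 (a + a') (b + b') (c + c').
Proof. by apply/rowP => -[[|[|[|]]]] //= ?; rewrite !mxE. Qed.

Lemma row3Z k a b c : k *: row3 a b c = row3 (k * a) (k * b) (k * c).
Proof. by apply/rowP => -[[|[|[|]]]] //= ?; rewrite !mxE. Qed.

Lemma row3_inj a b c a' b' c' : row3 a b c = row3 a' b' c' -> [/\ a = a', b = b' & c = c'].
Proof.
move/rowP => E; have := (E 0, E 1, E (lift 0 1)).
by rewrite !mxE /= => -[[]].
Qed.

Lemma mul_row3_sym2 x y z a b c d : row3 x y z *m sym2 (mx22 a b c d) =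
  row3 (x * a ^+ 2 + y * (2%:R * a * c) + z * c ^+ 2)
       (x * (a * b) + y * (a * d + b * c) + z * (c * d))
       (x * b ^+ 2 + y * (2%:R * b * d) + z * d ^+ 2).
Proof. by rewrite /sym2 !mxE /= mul_row3_rows3 !(row3Z, row3D). Qed.

Lemma row3_ext (A B : 'M[R]_3) :
  (forall x y z, row3 x y z *m A = row3 x y z *m B) -> A = B.
Proof.
move=> eqAB; apply/row_matrixP => i; rewrite !rowE.
by have [x [y [z ->]]] := row3P (delta_mx 0 i : 'rV[R]_3); apply: eqAB.
Qed.

Lemma sym2M g h : sym2 (g *m h) = sym2 g *m sym2 h.
Proof.
have [a [b [c [d ->]]]] := mx22P g; have [a' [b' [c' [d' ->]]]] := mx22P h.
apply: row3_ext => x y z; rewrite mul_mx22 mulmxA !mul_row3_sym2.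
by congr row3; ring.
Qed.

Lemma sym2_scalar a : sym2 a%:M = (a ^+ 2)%:M.
Proof.
apply: row3_ext => x y z; rewrite scalar_mx22 mul_row3_sym2 mul_mx_scalar row3Z.
by congr row3; ring.
Qed.

End Matrix2.

Lemma map_mx22 (R S : comNzRingType) (f : {rmorphism R -> S}) a b c d :
  map_mx f (mx22 a b c d) = mx22 (f a) (f b) (f c) (f d).
Proof.
by apply/matrixP => i j; rewrite !mxE; case: i j => [[|[|]]] //= ? [[|[|]]].
Qed.

Lemma sym2_unit (F : fieldType) (g : 'M[F]_2) : g \in unitmx -> sym2 g \in unitmx.
Proof.
move=> ug; have : sym2 g *m sym2 (invmx g) = 1%:M.
  by rewrite -sym2M mulmxV // sym2_scalar expr1n.
by case/mulmx1_unit.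
Qed.

(** * The action of GL(2,k) on the plane and its kernel *)

Section Conjugate.
Variables (k F : finFieldType) (f : {rmorphism k -> F}) (B : 'M[F]_3).
Hypothesis uB : B \in unitmx.
Implicit Types (g h : {'GL_2[k]}).

(** Conjugation by [B] transports the action from the coordinates of the Veronese conic to those of
    the plane. *)
Definition sym2_conj (g : 'M[k]_2) : 'M[F]_3 := invmx B *m sym2 (map_mx f g) *m B.

Lemma sym2_conj_unit g : sym2_conj (GLval g) \in unitmx.
Proof.
rewrite !unitmx_mul unitmx_inv uB andbT /=; apply: sym2_unit.
by rewrite map_unitmx (valP g).
Qed.

Definition sym2_perm g : {perm point F} := pperm (sym2_conj (GLval g)).

Lemma sym2_permM : {in [set: {'GL_2[k]}] &, {morph sym2_perm : g h / (g * h)%g}}.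
Proof.
move=> g h _ _; rewrite /sym2_perm -ppermM ?sym2_conj_unit //; congr pperm.
by rewrite /sym2_conj map_mxM sym2M !mulmxA mulmxK.
Qed.

Canonical sym2_morphism := Morphism sym2_permM.

Lemma sym2_perm_scalar g a : GLval g = a%:M -> sym2_perm g = 1%g.
Proof.
move=> Dg; have ua : a != 0.
  by apply: contraTneq (valP g) => a0; rewrite /= Dg a0 raddf0 unitr0.
rewrite /sym2_perm /sym2_conj Dg map_scalar_mx sym2_scalar mul_mx_scalar.
by rewrite -scalemxAl mulVmx // ppermZ ?unitmx1 ?pperm1 // expf_neq0 ?fmorph_eq0.
Qed.

(** Fixing the conic points (1 : 0 : 0) and (0 : 0 : 1) makes [g] diagonal, and fixing (1 : 1 : 1)
    makes its diagonal entries equal. *)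
Lemma sym2_perm_ker g : sym2_perm g = 1%g -> exists a, GLval g = a%:M.
Proof.
move=> g1; have [a [b [c [d Dg]]]] := mx22P (GLval g).
have fixP x y z : row3 x y z != 0 ->
    exists l, row3 x y z *m sym2 (mx22 (f a) (f b) (f c) (f d)) = l *: row3 x y z.
  move=> u0; set u := row3 x y z in u0 *.
  have uB0 : u *m B != 0 by apply: mulmx_unit_neq0.
  have /eqP/pt_eqP[||l El] : pt (u *m B *m sym2_conj (GLval g)) = pt (u *m B).
  - by rewrite -pperm_pt ?sym2_conj_unit // -/(sym2_perm g) g1 perm1.
  - exact: mulmx_unit_neq0 (sym2_conj_unit g) _.
  - by [].
  exists l; move: El; rewrite /sym2_conj Dg map_mx22 !mulmxA mulmxK // scalemxAl.
  exact: (can_inj (mulmxK uB)).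
have e_neq0 x y z : (x == 1) || (z == 1) -> row3 x y z != 0 :> 'rV[F]_3.
  apply: contraTneq => /rowP E; have := (E 0, E (lift 0 1)); rewrite !mxE /=.
  by case=> -> ->; rewrite eq_sym oner_eq0.
have [l1] : exists l, _ := fixP 1 0 0 (e_neq0 1 0 0 ltac:(by rewrite eqxx)).
have [l3] : exists l, _ := fixP 0 0 1 (e_neq0 0 0 1 ltac:(by rewrite eqxx orbT)).
have [l2] : exists l, _ := fixP 1 1 1 (e_neq0 1 1 1 ltac:(by rewrite eqxx)).
rewrite !mul_row3_sym2 !row3Z => /row3_inj[e1 e2 e3] /row3_inj[c0 _ _] /row3_inj[_ _ b0].
have {}b0 : b = 0.
  by move: b0; rewrite !mulr0 !mul0r !addr0 mul1r => /eqP; rewrite expf_eq0 fmorph_eq0 => /eqP.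
have {}c0 : c = 0.
  by move: c0; rewrite !mulr0 !mul0r !add0r mul1r => /eqP; rewrite expf_eq0 fmorph_eq0 => /eqP.
exists a; rewrite scalar_mx22 Dg b0 c0; congr mx22.
have a0 : a != 0.
  have := valP g; rewrite /= -[_ \is a _]/(GLval g \in unitmx) Dg b0 unitmxE det_mx22 mul0r subr0.
  by rewrite unitfE mulf_eq0 negb_or => /andP[].
apply/esym/(fmorph_inj f)/(mulfI (_ : f a != 0)); first by rewrite fmorph_eq0.
transitivity (l2 * 1); [rewrite -e1 | rewrite -e2]; rewrite ?b0 ?c0 ?rmorph0; ring.
Qed.

End Conjugate.

(** * Squares and the element -1 in a finite field *)

Section Squares.
Variable k : finFieldType.

Lemma finField_generator : exists2 z : k, z ^+ #|k|.-1 = 1 &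
  (forall m, (0 < m < #|k|.-1)%N -> z ^+ m != 1) /\
  (forall x, x != 0 -> exists m, x = z ^+ m).
Proof.
have /cyclicP[g Dg] := field_unit_group_cyclic [set: {unit k}].
have og : #[g]%g = #|k|.-1 by rewrite -card_finField_unit Dg.
exists (val g); first by rewrite -og -FinRing.val_unitX expg_order.
split=> [m /andP[m_gt0 lt_m] | x x0].
  rewrite -FinRing.val_unitX -[1]/(val (1%g : {unit k})) (inj_eq val_inj).
  by rewrite -order_dvdn og gtnNdvd.
have ux : x \is a GRing.unit by rewrite unitfE.
have : FinRing.unit k ux \in <[g]>%g by rewrite -Dg inE.
by case/cycleP=> m Dx; exists m; rewrite -FinRing.val_unitX -Dx.
Qed.

(* Half the order of the generator gives -1, so the parity of (#|k| - 1) / 2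
   decides whether -1 is a square. *)
Lemma finField_half_generator : odd #|k| -> exists2 z : k, z ^+ #|k|.-1./2 = -1 &
  (forall x, x != 0 -> exists m, x = z ^+ m).
Proof.
move=> odd_k; have [z z1 [zN1 zP]] := finField_generator; exists z => //.
have k_gt1 : (1 < #|k|)%N by apply: finNzRing_gt1.
have Dk : (#|k|.-1./2.*2 = #|k|.-1)%N.
  by case: #|k| odd_k k_gt1 => //= m; rewrite -[RHS]odd_double_half => /negbTE ->.
have lt_half : (0 < #|k|.-1./2 < #|k|.-1)%N.
  rewrite -Dk doubleK -addnn; case: _./2 (Dk) => [|m _]; last by rewrite /= addSn ltnS leq_addl.
  by case: #|k| k_gt1 => [|[]].
have /eqP : (z ^+ #|k|.-1./2) ^+ 2 = 1 by rewrite -exprM muln2 Dk.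
by rewrite sqrf_eq1 (negbTE (zN1 _ lt_half)) => /eqP.
Qed.

(** Here (#|k| - 1) / 2 is even, so half of this exponent gives a square root of -1. *)
Lemma finField_sqrtN1 : (#|k| %% 4 = 1)%N -> exists i : k, i ^+ 2 = -1.
Proof.
move=> k1; have [z zN1 _] : exists2 z : k, _ & _ := finField_half_generator ltac:(lia).
exists (z ^+ #|k|.-1./2./2); rewrite -exprM -zN1; congr (_ ^+ _); lia.
Qed.

(** Here (#|k| - 1) / 2 is odd: adding it to an odd exponent makes the exponent even, at the cost of
    a sign. *)
Lemma finField_sqr_or_oppsqr : (#|k| %% 4 = 3)%N ->
  forall x : k, exists e, x = e ^+ 2 \/ x = - e ^+ 2.
Proof.
move=> k3 x; case: (eqVneq x 0) => [->|x0]; first by exists 0; left; rewrite expr0n.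
have [z zN1 zP] : exists2 z : k, _ & _ := finField_half_generator ltac:(lia).
have [m ->] := zP x x0; case: (boolP (odd m)) => odd_m.
  exists (z ^+ (m + #|k|.-1./2)./2); right; rewrite -exprM.
  have -> : ((m + #|k|.-1./2)./2 * 2 = m + #|k|.-1./2)%N by lia.
  by rewrite exprD zN1 mulrN1 opprK.
by exists (z ^+ m./2); left; rewrite -exprM; congr (_ ^+ _); lia.
Qed.

End Squares.

(** * Transvections in GL(2,k) *)

Section GL2.
Variable k : finFieldType.
Implicit Types (g h : {'GL_2[k]}) (G : {group {'GL_2[k]}}).

(* Junk value: a singular matrix is sent to 1. *)
Definition gl2 (m : 'M[k]_2) : {'GL_2[k]} := insubd (1%g : {'GL_2[k]}) m.

Lemma gl2E (m : 'M[k]_2) : m \in unitmx -> GLval (gl2 m) = m.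
Proof. by move=> um; rewrite -[LHS]/(val (gl2 m)) /gl2 insubdK. Qed.

Lemma GLval_inj : injective (@GLval 2 k).
Proof. by move=> g h /(@val_inj _ _ {'GL_2[k]}). Qed.

Lemma gl2K g : gl2 (GLval g) = g.
Proof. by apply: GLval_inj; rewrite gl2E // -[_ \in _]/(GLval g \is a GRing.unit) GL_unit. Qed.

Lemma gl2M (m1 m2 : 'M[k]_2) : m1 \in unitmx -> m2 \in unitmx ->
  gl2 (m1 *m m2) = (gl2 m1 * gl2 m2)%g.
Proof.
move=> u1 u2; apply: GLval_inj.
by rewrite GL_MxE !gl2E // unitmx_mul u1.
Qed.

Lemma mx22_unit (a b c d : k) : (mx22 a b c d \in unitmx) = (a * d - b * c != 0).
Proof. by rewrite unitmxE det_mx22 unitfE. Qed.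

Definition upper (x : k) := gl2 (mx22 1 x 0 1).
Definition lower (x : k) := gl2 (mx22 1 0 x 1).

Lemma upper_unit (x : k) : mx22 1 x 0 1 \in unitmx.
Proof. by rewrite mx22_unit mulr1 mulr0 subr0 oner_eq0. Qed.

Lemma lower_unit (x : k) : mx22 1 0 x 1 \in unitmx.
Proof. by rewrite mx22_unit mulr1 mul0r subr0 oner_eq0. Qed.

Lemma upperX x m : (upper x ^+ m)%g = upper (x *+ m).
Proof.
elim: m => [|m IH].
  by apply: GLval_inj; rewrite expg0 /upper gl2E ?upper_unit // -scalar_mx22.
rewrite expgS IH /upper -gl2M ?upper_unit // mul_mx22; congr (gl2 (mx22 _ _ _ _));
  rewrite ?mulrS; ring.
Qed.

Lemma lowerX x m : (lower x ^+ m)%g = lower (x *+ m).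
Proof.
elim: m => [|m IH].
  by apply: GLval_inj; rewrite expg0 /lower gl2E ?lower_unit // -scalar_mx22.
rewrite expgS IH /lower -gl2M ?lower_unit // mul_mx22; congr (gl2 (mx22 _ _ _ _));
  rewrite ?mulrS; ring.
Qed.

(** A matrix of determinant 1 with nonzero lower left entry is a product upper, lower, upper of
    transvections. *)
Lemma SL2_transvections G g : (forall x, upper x \in G) -> (forall x, lower x \in G) ->
  \det (GLval g) = 1 -> g \in G.
Proof.
move=> uG lG; have [a [b [c [d Dg]]]] := mx22P (GLval g); rewrite Dg det_mx22 => det1.
have main a' b' c' d' : c' != 0 -> a' * d' - b' * c' = 1 -> gl2 (mx22 a' b' c' d') \in G.
  move=> c'0 det1'.
  suff -> : mx22 a' b' c' d' =
      mx22 1 ((a' - 1) / c') 0 1 *m mx22 1 0 c' 1 *m mx22 1 ((d' - 1) / c') 0 1.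
    rewrite !gl2M ?unitmx_mul ?upper_unit ?lower_unit //.
    by rewrite !groupM // -/(upper _) -/(lower _).
  rewrite !mul_mx22; congr mx22; try by field.
  have -> : b' = (a' * d' - 1) / c' by rewrite -det1'; field.
  by field.
rewrite -(gl2K g) Dg; case: (eqVneq c 0) => [c0|c0]; last exact: main.
have a0 : a != 0.
  by apply: contra_eq_neq det1 => ->; rewrite c0 !(mul0r, mulr0) subr0 eq_sym oner_eq0.
(* Left multiplication by [lower 1] brings the nonzero entry [a] to the lower left corner. *)
rewrite -(groupMl _ (lG 1)) /lower -gl2M ?lower_unit ?mx22_unit ?det1 ?oner_eq0 //.
rewrite mul_mx22; apply: main; first by rewrite !mul1r c0 addr0.
by rewrite -[RHS]det1; ring.
Qed.

(** Two transvections suffice to force scalarity, so the center is known for every group containing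
    them, SL and GL alike. *)
Lemma cent_transvections g : commute g (upper 1) -> commute g (lower 1) ->
  exists a, GLval g = a%:M.
Proof.
have [a [b [c [d Dg]]]] := mx22P (GLval g).
move=> /(congr1 (@GLval 2 k)) eu /(congr1 (@GLval 2 k)) el; move: eu el.
rewrite !GL_MxE !gl2E ?upper_unit ?lower_unit // Dg !mul_mx22.
rewrite !(mulr1, mulr0, mul0r, mul1r, addr0, add0r).
move=> /mx22_inj[ac ab _ _] /mx22_inj[ab' _ _ _].
have c0 : c = 0 by apply: (addrI a); rewrite -ac addr0.
have b0 : b = 0 by apply: (addrI a); rewrite ab' addr0.
by exists a; rewrite scalar_mx22 b0 c0; move: ab; rewrite b0 addr0 add0r => ->.
Qed.

Lemma scalar_central g h a : GLval g = a%:M -> (g * h = h * g)%g.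
Proof. by move=> Dg; apply: GLval_inj; rewrite !GL_MxE Dg scalar_mxC. Qed.

End GL2.

(** * Images of subgroups of GL(2,k) modulo scalars *)

Section Image.
Variables (k F : finFieldType) (f : {rmorphism k -> F}) (B : 'M[F]_3).
Hypothesis uB : B \in unitmx.
Let phi := sym2_morphism f uB.
Implicit Types (g h : {'GL_2[k]}) (G : {group {'GL_2[k]}}).

(** Both sides consist of the scalar matrices of [G]. *)
Lemma center_ker G : upper 1 \in G -> lower 1 \in G -> ('Z(G) = 'ker_G phi)%g.
Proof.
move=> uG lG; apply/setP => g; rewrite !inE /=; case: (boolP (g \in G)) => //= gG.
apply/idP/eqP => [/centP cg | /(sym2_perm_ker uB)[a Dg]].
  by have [a /(sym2_perm_scalar f uB)] := cent_transvections (cg _ uG) (cg _ lG).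
by apply/centP => h _; apply: scalar_central Dg.
Qed.

Lemma quotient_center_isog G : upper 1 \in G -> lower 1 \in G ->
  phi @* G \isog (G / 'Z(G))%g.
Proof.
by move=> uG lG; rewrite isog_sym center_ker // first_isog_loc // subsetT.
Qed.

(** Dividing [g] by the scalar [e] does not change its image. *)
Lemma sqr_det_mod_scalars g e : \det (GLval g) = e ^+ 2 ->
  exists2 h, \det (GLval h) = 1 & phi g = phi h.
Proof.
move=> dg; have e0 : e != 0.
  by move: (GL_det g); rewrite dg; apply: contraNneq => ->; rewrite expr0n.
have ug : GLval g \in unitmx by rewrite unitmxE unitfE GL_det.
have ue : (e%:M : 'M[k]_2) \in unitmx by rewrite unitmxE det_scalar unitfE expf_neq0.
exists (gl2 (e^-1 *: GLval g)).
  by rewrite gl2E ?unitmxZ ?unitfE ?invr_eq0 // detZ dg exprVn mulVf // expf_neq0.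
have Dg : g = (gl2 e%:M * gl2 (e^-1 *: GLval g))%g.
  rewrite -gl2M ?ue ?unitmxZ ?unitfE ?invr_eq0 //.
  by rewrite mul_scalar_mx scalerA divff // scale1r gl2K.
rewrite {1}Dg morphM ?inE // [phi (gl2 e%:M)](@sym2_perm_scalar _ _ f B uB _ e) ?mul1g //.
by rewrite gl2E ?ue.
Qed.

End Image.

Lemma det_upper (k : finFieldType) (x : k) : \det (GLval (upper x)) = 1.
Proof. by rewrite gl2E ?upper_unit // det_mx22 mulr1 mulr0 subr0. Qed.

Lemma det_lower (k : finFieldType) (x : k) : \det (GLval (lower x)) = 1.
Proof. by rewrite gl2E ?lower_unit // det_mx22 mulr1 mul0r subr0. Qed.

(** * The group generated by the three matrices *)

Section Generation.
Variable k : finFieldType.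

(** On the parameters (s : t) these three involutions fix, respectively, (1 : 0) and (0 : 1), then
    (0 : 1) and (1 : 1), then (1 : 0) and (1 : 1): the two points of tangency on the tangents
    through P, Q, R. *)
Definition genP : {'GL_2[k]} := gl2 (mx22 (-1) 0 0 1).
Definition genQ : {'GL_2[k]} := gl2 (mx22 (-1) (- 2%:R) 0 1).
Definition genR : {'GL_2[k]} := gl2 (mx22 (-1) 0 2%:R 1).

Lemma genP_unit : (mx22 (-1) 0 0 1 : 'M[k]_2) \in unitmx.
Proof. by rewrite mx22_unit mulr1 mul0r subr0 oppr_eq0 oner_eq0. Qed.

Lemma genQ_unit : (mx22 (-1) (- 2%:R) 0 1 : 'M[k]_2) \in unitmx.
Proof. by rewrite mx22_unit mulr1 mulr0 subr0 oppr_eq0 oner_eq0. Qed.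

Lemma genR_unit : (mx22 (-1) 0 2%:R 1 : 'M[k]_2) \in unitmx.
Proof. by rewrite mx22_unit mulr1 mul0r subr0 oppr_eq0 oner_eq0. Qed.

Lemma genPQ : (genP * genQ)%g = upper 2%:R.
Proof.
rewrite -gl2M ?genP_unit ?genQ_unit // mul_mx22.
by congr (gl2 (mx22 _ _ _ _)); ring.
Qed.

Lemma genPR : (genP * genR)%g = lower 2%:R.
Proof.
rewrite -gl2M ?genP_unit ?genR_unit // mul_mx22.
by congr (gl2 (mx22 _ _ _ _)); ring.
Qed.

Definition gens := [set genP; genQ; genR].

Lemma det_gens g : g \in gens -> \det (GLval g) = -1.
Proof.
rewrite !inE -orbA => /or3P[] /eqP ->;
  rewrite gl2E ?genP_unit ?genQ_unit ?genR_unit // det_mx22; ring.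
Qed.

(** Over ['F_p] this unfolds to the same set as [SL2 p]. *)
Definition SL : {set {'GL_2[k]}} := [set g | \det (GLval g) == 1].

Lemma SL_group_set : group_set SL.
Proof.
apply/group_setP; split=> [|g h]; first by rewrite inE det1.
by rewrite !inE GL_MxE det_mulmx => /eqP-> /eqP->; rewrite mulr1.
Qed.

Canonical SL_group := Group SL_group_set.

Hypotheses (two_neq0 : 2%:R != 0 :> k) (natP : forall x : k, exists m, x = m%:R).

(** Since 2 is invertible and every element is a multiple of 1, every element is also a multiple of
    2, so the powers of [u 2] exhaust the family. *)
Lemma mem_prime_field_multiples (G : {group {'GL_2[k]}}) (u : k -> {'GL_2[k]}) :
  (forall x m, (u x ^+ m)%g = u (x *+ m)) -> u 2%:R \in G -> forall x, u x \in G.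
Proof.
move=> uX u2 x; have [m Dm] := natP (x / 2%:R).
have -> : x = 2%:R *+ m by rewrite -mulr_natr -Dm mulrC divfK.
by rewrite -uX groupX.
Qed.

Lemma SL_sub_gens : SL \subset <<gens>>%g.
Proof.
have [gP gQ gR] : [/\ genP \in <<gens>>, genQ \in <<gens>> & genR \in <<gens>>]%g.
  by split; apply: mem_gen; rewrite !inE eqxx ?orbT.
apply/subsetP => g; rewrite inE => /eqP; apply: SL2_transvections.
  by apply: (mem_prime_field_multiples (@upperX k)); rewrite -genPQ groupM.
by apply: (mem_prime_field_multiples (@lowerX k)); rewrite -genPR groupM.
Qed.

Variables (F : finFieldType) (f : {rmorphism k -> F}) (B : 'M[F]_3).
Hypothesis uB : B \in unitmx.
Let phi := sym2_morphism f uB.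

Lemma image_gens : (phi @* <<gens>>)%g =
  <<[set sym2_perm f B genP; sym2_perm f B genQ; sym2_perm f B genR]>>%g.
Proof. by rewrite morphim_gen ?subsetT // !morphimU !morphim_set1 ?in_setT. Qed.

Lemma image_gens_SL : (#|k| %% 4 = 1)%N -> (phi @* <<gens>> = phi @* SL)%g.
Proof.
move=> /finField_sqrtN1[i i2].
apply/eqP; rewrite eqEsubset andbC morphimS ?SL_sub_gens //=.
rewrite morphim_gen ?subsetT // gen_subG; apply/subsetP => _ /morphimP[g _ gG ->].
have [|h h1 ->] := @sqr_det_mod_scalars _ _ f B uB g i; first by rewrite det_gens ?i2.
by apply: mem_morphim; rewrite ?inE // h1.
Qed.

Lemma image_gens_GL : (#|k| %% 4 = 3)%N -> (phi @* <<gens>> = phi @* 'GL_2[k])%g.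
Proof.
move=> /finField_sqr_or_oppsqr sq.
apply/eqP; rewrite eqEsubset morphimS ?subsetT //=.
apply/subsetP => _ /morphimP[g _ _ ->].
have sqG h e : \det (GLval h) = e ^+ 2 -> phi h \in (phi @* <<gens>>)%g.
  case/(@sqr_det_mod_scalars _ _ f B uB) => h' h1 ->.
  by apply: mem_morphim; rewrite ?inE // (subsetP SL_sub_gens) // inE h1.
have [e [|dg]] := sq (\det (GLval g)); first exact: sqG.
(* When the determinant is minus a square, multiplying by [genP], of determinant -1, returns to the
   square case. *)
have gP : genP \in gens by rewrite !inE eqxx.
have : phi (g * genP)%g \in (phi @* <<gens>>)%g.
  by apply: (sqG _ e); rewrite GL_MxE det_mulmx dg det_gens // mulrNN mulr1.
rewrite morphM ?inE // groupMr //; apply: mem_morphim; rewrite ?inE //.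
exact: mem_gen.
Qed.

Lemma image_gens_isog_SL : (#|k| %% 4 = 1)%N -> (phi @* <<gens>>)%g \isog (SL / 'Z(SL))%g.
Proof.
move=> k1; rewrite image_gens_SL //.
by apply: quotient_center_isog; rewrite inE ?det_upper ?det_lower.
Qed.

Lemma image_gens_isog_GL : (#|k| %% 4 = 3)%N ->
  (phi @* <<gens>>)%g \isog ('GL_2[k] / 'Z('GL_2[k]))%g.
Proof.
move=> k3; rewrite image_gens_GL //.
by apply: quotient_center_isog; apply: in_setT.
Qed.

End Generation.

(** In characteristic [p] the field is an algebra over ['F_p], and the embedding is its structure
    map. *)
Lemma Fp_rmorphism (p n : nat) (F : finFieldType) : prime p -> #|F| = (p ^ n)%N ->
  inhabited {rmorphism 'F_p -> F}.
Proof.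
move=> p_pr Fpn; have pF := card_finPcharP Fpn p_pr.
have f : {rmorphism 'F_p -> pPrimeCharType pF} := GRing.in_alg (pPrimeCharType pF).
by constructor; exact: f.
Qed.

(** * The three involutions as images of matrices over the small field *)

Section AlphaImage.
Variables (k F : finFieldType) (C : 'M[F]_3) (v1 v2 v3 : 'rV[F]_3) (c : F).
Variable f : {rmorphism k -> F}.
Hypotheses (two_neq0 : 2%:R != 0 :> F) (symC : C^T = C) (c_neq0 : c != 0).
Hypotheses (g11 : bform C v1 v1 = 0) (g22 : bform C v2 v2 = 0) (g33 : bform C v3 v3 = 0).
Hypotheses (g12 : bform C v1 v2 = c) (g13 : bform C v1 v3 = c) (g23 : bform C v2 v3 = c).

Let B := frame v1 v2 v3.
Let uB : B \in unitmx.
Proof. exact: (frame_unit two_neq0 symC c_neq0). Qed.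

(** By [alpha_refl], applied to the three vectors in each order, it suffices to compute the action
    of each matrix on [v1], [v2], [v3]. *)
Lemma alpha_gens :
  [/\ alpha (conic C) (pt (vertex v1 v2 v3)) = sym2_perm f B (genP k),
      alpha (conic C) (pt (vertex v2 v3 v1)) = sym2_perm f B (genQ k) &
      alpha (conic C) (pt (vertex v1 v3 v2)) = sym2_perm f B (genR k)].
Proof.
have g21 : bform C v2 v1 = c by rewrite bformC.
have g31 : bform C v3 v1 = c by rewrite bformC.
have g32 : bform C v3 v2 = c by rewrite bformC.
(* These are the Veronese coordinates for the parameters (1 : 0), (0 : 1), (1 : 1). *)
have D1 : v1 = row3 1 0 0 *m B by rewrite mul_row3_frame !subr0 -comb3_100.
have D2 : v2 = row3 0 0 1 *m B by rewrite mul_row3_frame !subr0 -comb3_010.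
have D3 : v3 = row3 1 1 1 *m B by rewrite mul_row3_frame !subrr -comb3_001.
have act x y z a b c' d : row3 x y z *m B *m sym2_conj f B (mx22 a b c' d) =
    row3 x y z *m sym2 (mx22 (f a) (f b) (f c') (f d)) *m B.
  by rewrite /sym2_conj map_mx22 !mulmxA mulmxK.
rewrite /sym2_perm !gl2E ?genP_unit ?genQ_unit ?genR_unit //.
have f0 := rmorph0 f; have f1 := rmorph1 f; have f2 := rmorph_nat f 2; have fN := rmorphN f.
split; apply: (alpha_refl two_neq0 symC c_neq0) => //;
  rewrite ?D1 ?D2 ?D3 -?scaleN1r act mul_row3_sym2 ?(scalemxAl, =^~ mulmxDl, row3Z, row3D);
  by congr (row3 _ _ _ *m _); rewrite ?(fN, f0, f1, f2); ring.
Qed.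

End AlphaImage.

Theorem mainTheorem10 (p n : nat) (F : finFieldType) (C : 'M[F]_3)
  (t1 t2 t3 : {set point F}) (P Q R : point F) :
  prime p -> odd p -> (0 < n)%N -> #|F| = (p ^ n)%N ->
  nondeg_conic_mx C ->
  tangent_line (conic C) t1 -> tangent_line (conic C) t2 ->
  tangent_line (conic C) t3 ->
  t1 != t2 -> t2 != t3 -> t1 != t3 ->
  t1 :&: t2 = [set P] -> t2 :&: t3 = [set Q] -> t1 :&: t3 = [set R] ->
  let H := <<[set alpha (conic C) P; alpha (conic C) Q; alpha (conic C) R]>>%g in
  (p %% 4 = 1 -> H \isog PSL2 p)%N /\ (p %% 4 = 3 -> H \isog PGL2 p)%N.
Proof.
move=> p_pr p_odd _ Fpn nondegC tan1 tan2 tan3 n12 n23 n13 DP DQ DR.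
have [f] := Fp_rmorphism p_pr Fpn.
have two_neq0 : (2%:R != 0 :> F)%R.
  rewrite -(dvdn_pcharf (card_finPcharP Fpn p_pr)); apply: contraL p_odd.
  by rewrite dvdn_prime2 // => /eqP ->.
have symC : (C^T = C)%R by case/andP: nondegC => /eqP.
have [v1 [v2 [v3 [c [c0 [[g11 g22 g33] [[g12 g13 g23] [-> -> ->]]]]]]]] :=
  tangent_triangle two_neq0 nondegC tan1 tan2 tan3 n12 n23 n13 DP DQ DR.
have two_neq0' : (2%:R != 0 :> 'F_p)%R.
  by apply: contraNneq two_neq0 => F2; rewrite -(rmorph_nat f) F2 rmorph0.
have natP (x : 'F_p) : exists m, (x = m%:R)%R by exists x; rewrite natr_Zp.
have uB := frame_unit two_neq0 symC c0 g11 g22 g33 g12 g13 g23.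
have [-> -> ->] := alpha_gens f two_neq0 symC c0 g11 g22 g33 g12 g13 g23.
rewrite /= -(image_gens f uB).
by split=> p4; [apply: image_gens_isog_SL | apply: image_gens_isog_GL];
  rewrite ?card_Fp.
Qed.
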